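(* Let $S$ be a subring of a finite ring $R$. Then \[ \Pr(S,R)\ge \frac{1}{|K(S,R)|}\left(1+\frac{|K(S,R)|-1}{|S:Z(S,R)|}\right). \] In particular, if $Z(S,R)\ne S$ then $\Pr(S,R)>\dfrac{1}{|K(S,R)|}$.
   Context: Rings are associative and are not required to have an identity; a subring is an additive subgroup closed under multiplication. For a subring $S$ of a finite ring $R$: $[s,r]=sr-rs$; $K(S,R)=\{[s,r]: s\in S, r\in R\}$ (a set, not necessarily a subgroup); $Z(S,R)=\{s\in S: sr=rs \text{ for all } r\in R\}$; $|S:Z(S,R)|$ is the index of the additive subgroup $Z(S,R)$ in $(S,+)$; and $\Pr(S,R)=\dfrac{|\{(s,r)\in S\times R: sr=rs\}|}{|S|\,|R|}$. *)

(* Defs.v *)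
From HB Require Import structures.
From mathcomp Require Import all_boot all_order all_fingroup all_algebra.

Set Implicit Arguments.
Unset Strict Implicit.
Unset Printing Implicit Defensive.

Import GRing.Theory.
Local Open Scope ring_scope.

(* The ring structures of ssralg all have a 1, so associative rings without    *)
(* a required identity are introduced as a separate structure over zmodType.  *)
HB.mixin Record Zmodule_isRng R of GRing.Zmodule R := {
  rmul : R -> R -> R;
  rmulA : associative rmul;
  rmulDl : left_distributive rmul +%R;
  rmulDr : right_distributive rmul +%R
}.

#[short(type="finRngType")]
HB.structure Definition FinRng := {R of Zmodule_isRng R & FinRing.Zmodule R}.

(* As for the structures of finalg, the underlying group is (R, +), so that   *)
(* #|A : B|%g below is an index of additive subgroups.                        *)
HB.instance Definition _ (R : FinRng.type) := [finGroupMixin of R for +%R].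

Declare Scope rng_scope.
Delimit Scope rng_scope with rng.
Notation "x * y" := (rmul x y) : rng_scope.

Section RelativeCommutativity.
Variable R : finRngType.
Implicit Types (S : {set R}) (s r : R).

Definition subrng S : Prop :=
  GRing.zmod_closed S /\ {in S &, forall x y, (x * y)%rng \in S}.

Definition rng_comm s r : R := (s * r)%rng - (r * s)%rng.

Definition commset S : {set R} := [set rng_comm s r | s in S, r in [set: R]].

Definition relcenter S : {set R} :=
  [set s in S | [forall r : R, (s * r)%rng == (r * s)%rng]].

Definition relPr S : rat :=
  #|[set p in setX S [set: R] | (p.1 * p.2)%rng == (p.2 * p.1)%rng]|%:R
    / (#|S|%:R * #|R|%:R).

End RelativeCommutativity.

(* Main.v *)
Require Import Defs.
From mathcomp Require Import all_boot all_order all_fingroup all_algebra.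
From mathcomp Require Import ring.

Local Open Scope ring_scope.

(** Counting commuting pairs row by row, [|S| |R| Pr(S,R)] is the sum over
    [s] in [S] of the order of the centralizer of [s] in [R].  The map
    [r |-> [s, r]] is additive with that centralizer as kernel and takes its
    values in [K(S,R)], so every centralizer has order at least
    [|R| / |K(S,R)|] ([card_rng_le_comm_centralizer]).  The elements of
    [Z(S,R)] do better: their centralizer is all of [R].  Using the
    general bound only for the [|S| - |Z|] other elements, the sum is at least
    [|Z| |R| + (|S| - |Z|) |R| / |K|] ([card_commuting_pairs_ge]), and division
    by [|S| |R|], with [|S| = |Z| |S : Z|] from Lagrange's theorem, gives the
    stated bound.  It exceeds [1 / |K|] as soon as [K] has a nonzero element,
    that is, as soon as [Z] differs from [S]. *)

Import Order.TTheory GRing.Theory Num.Theory.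

Section Counting.
Variable R : finRngType.
Implicit Types (S : {set R}) (s r : R).

Definition rng_centralizer s : {set R} :=
  [set r | (s * r)%rng == (r * s)%rng].

Lemma rng_commDr s : {morph rng_comm s : r t / r + t}.
Proof. by move=> r t; rewrite /rng_comm rmulDr rmulDl opprD addrACA. Qed.

Lemma rng_comm0r s : rng_comm s 0 = 0.
Proof. by apply: (addIr (rng_comm s 0)); rewrite -rng_commDr !add0r. Qed.

Lemma rng_commNr s : {morph rng_comm s : r / - r}.
Proof.
by move=> r; apply: (addIr (rng_comm s r)); rewrite -rng_commDr !addNr rng_comm0r.
Qed.

Lemma rng_commBr s : {morph rng_comm s : r t / r - t}.
Proof. by move=> r t; rewrite rng_commDr rng_commNr. Qed.

Lemma mem_rng_centralizer s r : (r \in rng_centralizer s) = (rng_comm s r == 0).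
Proof. by rewrite inE subr_eq0. Qed.

(** A fibre is empty or, by additivity, a translate of the fibre over [0]. *)
Lemma card_rng_comm_fibre s k :
  (#|[set r | rng_comm s r == k]| <= #|rng_centralizer s|)%N.
Proof.
have [->|[r0]] := set_0Vmem [set r | rng_comm s r == k]; first by rewrite cards0.
rewrite inE => /eqP r0k.
rewrite -(card_imset _ (addIr (- r0))); apply/subset_leq_card/subsetP=> x.
case/imsetP=> r; rewrite inE => /eqP rk ->.
by rewrite mem_rng_centralizer rng_commBr rk r0k subrr.
Qed.

Lemma mem_commset S s r : s \in S -> rng_comm s r \in commset S.
Proof. by move=> sS; apply: imset2_f; rewrite ?inE. Qed.

(** [R] is covered by the fibres of [r |-> [s, r]] over [K(S,R)], none of
    which is larger than the kernel. *)
Lemma card_rng_le_comm_centralizer S s : s \in S ->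
  (#|R| <= #|commset S| * #|rng_centralizer s|)%N.
Proof.
move=> sS; rewrite -[leqLHS]sum1_card.
rewrite (partition_big (rng_comm s) [in commset S]) /=; last first.
  by move=> r _; apply: mem_commset.
rewrite -sum_nat_const; apply: leq_sum => k _.
by rewrite sum1dep_card; apply: card_rng_comm_fibre.
Qed.

Lemma card_commuting_pairs S :
  #|[set p in setX S [set: R] | (p.1 * p.2)%rng == (p.2 * p.1)%rng]|
    = (\sum_(s in S) #|rng_centralizer s|)%N.
Proof.
under eq_bigr => s _ do rewrite -sum1dep_card.
rewrite pair_big_dep /= sum1dep_card; congr #|pred_of_set _|.
by apply/setP=> p; rewrite !inE andbT.
Qed.

Lemma rng_centralizer_relcenter S s : s \in relcenter S ->
  rng_centralizer s = [set: R].
Proof.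
rewrite inE => /andP[_ /forallP sZ].
by apply/setP=> r; rewrite !inE sZ.
Qed.

Lemma relcenter_sub S : relcenter S \subset S.
Proof. by apply/subsetP=> s /setIdP[]. Qed.

(** The bound on [Pr(S,R)] with denominators cleared: each [s] in [S] accounts
    for [|R|] on the left, and each central [s] for [(|K| - 1) |R|] more. *)
Lemma card_commuting_pairs_ge S :
  (#|R| * (#|S| + #|commset S|.-1 * #|relcenter S|)
    <= #|commset S| * \sum_(s in S) #|rng_centralizer s|)%N.
Proof.
have cardZ : #|relcenter S| = (\sum_(s in S) (s \in relcenter S))%N.
  rewrite -big_mkcondr /= sum1dep_card; apply: eq_card => s.
  by rewrite !inE andbA andbb.
rewrite cardZ -sum1_card big_distrr -big_split /= !big_distrr /=.
apply: leq_sum => s sS; have [sZ|_] := boolP (s \in relcenter S).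
  rewrite (rng_centralizer_relcenter _ _ sZ) cardsT muln1 add1n mulnC prednK //.
  by apply/card_gt0P; exists (rng_comm s 0); apply: mem_commset.
by rewrite muln0 addn0 muln1; apply: card_rng_le_comm_centralizer.
Qed.

Lemma commset_gt1 S : relcenter S <> S -> (1 < #|commset S|)%N.
Proof.
move=> ZnS; have /subsetPn[s sS] : ~~ (S \subset relcenter S).
  by apply/negP=> sSZ; apply/ZnS/eqP; rewrite eqEsubset relcenter_sub.
rewrite inE sS /= negb_forall => /existsP[r]; rewrite -subr_eq0 => sr_neq0.
apply/card_gt1P; exists (rng_comm s r), (rng_comm s 0).
by split; rewrite ?mem_commset // rng_comm0r.
Qed.

Lemma zmod_closed_group_set S : GRing.zmod_closed S -> group_set S.
Proof.
move=> [S0 SB]; apply/group_setP; split=> // x y xS yS.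
have NyS : - y \in S by rewrite -[- y]add0r SB.
by rewrite -[(x * y)%g]/(x + y) -[y]opprK SB.
Qed.

Lemma relcenter_group_set S : subrng S -> group_set (relcenter S).
Proof.
move=> [[S0 SB] _]; apply: zmod_closed_group_set.
(* With the commutator written [r, s], s varies in the second argument, where
   additivity is available. *)
have memZ s : (s \in relcenter S) = (s \in S) && [forall r, rng_comm r s == 0].
  by rewrite inE; congr (_ && _); apply: eq_forallb=> r; rewrite subr_eq0 eq_sym.
split=> [|x y]; rewrite !memZ.
  by rewrite S0; apply/forallP=> r; rewrite rng_comm0r.
move=> /andP[xS /forallP xZ] /andP[yS /forallP yZ]; rewrite SB //.
by apply/forallP=> r; rewrite rng_commBr (eqP (xZ r)) (eqP (yZ r)) subrr.
Qed.

Lemma relcenter_Lagrange S : subrng S ->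
  (#|relcenter S| * #|S : relcenter S|%g)%N = #|S|.
Proof.
move=> subS.
exact: (@Lagrange R (Group (zmod_closed_group_set _ subS.1))
          (Group (relcenter_group_set _ subS)) (relcenter_sub S)).
Qed.

End Counting.

Theorem theorem2p16 (R : finRngType) (S : {set R}) (subS : subrng S) :
  relPr S >= 1 / #|commset S|%:R
             * (1 + (#|commset S|%:R - 1) / #|S : relcenter S|%g%:R)
  /\ (relcenter S <> S -> relPr S > 1 / #|commset S|%:R).
Proof.
have S0 : 0 \in S by case: subS => -[].
have R_gt0 : (0 < #|R|)%N by apply/card_gt0P; exists 0.
have K_gt0 : (0 < #|commset S|)%N.
  by apply/card_gt0P; exists (rng_comm 0 0); apply: mem_commset.
have S_gt0 : (0 < #|S|)%N by apply/card_gt0P; exists 0.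
have defS := relcenter_Lagrange _ _ subS.
have /andP[Z_gt0 i_gt0] : (0 < #|relcenter S|)%N && (0 < #|S : relcenter S|%g)%N.
  by rewrite -muln_gt0 defS.
have bound : 1 / #|commset S|%:R
             * (1 + (#|commset S|%:R - 1) / #|S : relcenter S|%g%:R) <= relPr S.
  have := card_commuting_pairs_ge _ S; rewrite /relPr card_commuting_pairs.
  rewrite -(ler_nat rat) !(natrM, natrD) -subn1 natrB // -defS natrM => le_pairs.
  (* Clearing denominators makes the claimed bound equal to the lower bound
     of le_pairs. *)
  rewrite ler_pdivlMr ?mulr_gt0 ?ltr0n //.
  rewrite -(@ler_pM2l _ #|commset S|%:R) ?ltr0n //.
  apply: le_trans le_pairs; rewrite le_eqVlt; apply/orP; left; apply/eqP.
  by field; rewrite !pnatr_eq0 -!lt0n K_gt0 i_gt0.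
split=> // /commset_gt1 K_gt1; apply: lt_le_trans bound.
rewrite ltr_pMr ?divr_gt0 ?ltr0n // ltrDl divr_gt0 ?ltr0n //.
by rewrite subr_gt0 ltr1n.
Qed.
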